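(* For $n\ge 0$ let $D_n(t)=\sum_{\pi\in D_n}t^{\operatorname{des}_D(\pi)}$ be the type D Eulerian polynomial (with $D_0(t)=D_1(t)=1$), and let \[Q_n(t)=\sum_{k=0}^{n-1}D_k(t)\binom{n}{k}(t-1)^{n-k-1}.\] Then for every $n\ge 2$, \[D_n(t)=Q_n(t)+t^nQ_n(t^{-1}).\]
   Context: A signed permutation of $[n]$ is a bijection $\pi$ of $[-n,n]$ with $\pi(-i)=-\pi(i)$, written in window notation $[\pi(1),\dots,\pi(n)]$. $D_n$ is the group of even signed permutations: signed permutations with an even number of negative entries among $\pi(1),\dots,\pi(n)$. Let $\operatorname{Des}(\pi)=\{i\in[n-1]:\pi(i)\ge\pi(i+1)\}$, and let $\operatorname{Des}_D(\pi)=\operatorname{Des}(\pi)$ if $\pi(1)+\pi(2)>0$ and $\operatorname{Des}_D(\pi)=\operatorname{Des}(\pi)\cup\{0\}$ if $\pi(1)+\pi(2)<0$; $\operatorname{des}_D(\pi)=|\operatorname{Des}_D(\pi)|$. For $n\le 1$ the group $D_n$ has one element with no descents. *)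

(* Defs.v *)
From HB Require Import structures.
From mathcomp Require Import all_boot all_order all_algebra all_fingroup.
From mathcomp Require Import fraction.

Set Implicit Arguments.
Unset Strict Implicit.
Unset Printing Implicit Defensive.

Import Order.TTheory GRing.Theory Num.Theory.
Local Open Scope ring_scope.

(* The interval [-n, n] is represented by the ordinals below 2n + 1, the ordinal
   j standing for the integer j - n; thus rev_ord is the negation i |-> - i. *)
Definition ival (n : nat) (j : 'I_(n.*2.+1)) : int := (j : nat)%:Z - n%:Z.

Lemma ival_rev_ord (n : nat) (j : 'I_(n.*2.+1)) : ival (rev_ord j) = - ival j.
Proof.
have jn : (j <= n.*2)%N by rewrite -ltnS.
rewrite /ival /= subSS -subzn //; move: (nat_of_ord j) => {jn}k.
by rewrite -addnn PoszD opprB addrAC addrK.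
Qed.

Definition signed_perm (n : nat) (pi : {perm 'I_(n.*2.+1)}) : bool :=
  [forall i, pi (rev_ord i) == rev_ord (pi i)].

(* The integer pi(i); only meaningful for i <= n, as inord has a default value
   otherwise. *)
Definition spval (n : nat) (pi : {perm 'I_(n.*2.+1)}) (i : nat) : int :=
  ival (pi (inord (n + i))).

(* The i-th entry of the window is spval pi i.+1, for i : 'I_n. *)
Definition typeD (n : nat) : {set {perm 'I_(n.*2.+1)}} :=
  [set pi | signed_perm pi & ~~ odd #|[set i : 'I_n | spval pi i.+1 < 0]|].

(* Descent sets are subsets of {0, ..., n - 1}, i.e. of 'I_n. *)
Definition Des (n : nat) (pi : {perm 'I_(n.*2.+1)}) : {set 'I_n} :=
  [set i : 'I_n | (0 < i)%N & spval pi i >= spval pi i.+1].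

(* The guard 1 < n is needed for pi(2) to make sense; for n <= 1 there are no
   descents. *)
Definition DesD (n : nat) (pi : {perm 'I_(n.*2.+1)}) : {set 'I_n} :=
  if (1 < n)%N && (spval pi 1 + spval pi 2 < 0)
  then Des pi :|: [set i : 'I_n | i == 0%N :> nat]
  else Des pi.

Definition desD (n : nat) (pi : {perm 'I_(n.*2.+1)}) : nat := #|DesD pi|.

Definition eulerD (n : nat) : {poly int} := \sum_(pi in typeD n) 'X^(desD pi).

Lemma eulerD0 : eulerD 0 = 1.
Proof.
have S1 (p : {perm 'I_1}) : p = 1%g by apply/permP => i; rewrite !ord1.
rewrite /eulerD (big_pred1 1%g) => [|p].
  rewrite /desD (_ : DesD _ = set0) ?cards0 ?expr0 //.
  by apply/setP => -[].
rewrite (S1 p) inE /= eqxx /signed_perm.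
apply/andP; split; first by apply/forallP=> i; rewrite !perm1.
by rewrite (_ : [set _ | _] = set0) ?cards0 //; apply/setP => -[].
Qed.
Lemma eulerD1 : eulerD 1 = 1.
Proof.
have io : inord 2 = Ordinal (isT : 2 < 1.*2.+1)%N by apply/val_inj; rewrite /= inordK.
have cond (p : {perm 'I_(1.*2.+1)}) : (p \in typeD 1) = (p == 1%g).
  rewrite inE; apply/andP/eqP => [[/forallP S]|->]; last first.
    split; first by apply/forallP=> i; rewrite !perm1.
    rewrite (_ : [set _ | _] = set0) ?cards0 //; apply/setP => i.
    by rewrite !inE ord1 /spval perm1 /ival io.
  move=> E; have p2 : (1 < p (inord 2))%N || (p (inord 2) == 1%N :> nat).
    apply: contraR E; rewrite negb_or -leqNgt => /andP[a b].
    rewrite (_ : [set _ | _] = setT) ?cardsT ?card_ord //.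
    apply/setP => i; rewrite !inE ord1 /spval /ival.
    rewrite addn1; case: (p (inord 2)) a b => -[|[|m]] //=.
  have p1 : p (Ordinal (isT : 1 < 3)%N) = Ordinal (isT : 1 < 3)%N.
    move: (S (Ordinal (isT : 1 < 3)%N)) => /eqP.
    rewrite (_ : rev_ord _ = Ordinal (isT : 1 < 3)%N); last exact: val_inj.
    move/(congr1 val) => /= H; apply/val_inj => /=; move: H.
    by case: (p _) => -[|[|[|m]]].
  have p2' : p (Ordinal (isT : 2 < 3)%N) = Ordinal (isT : 2 < 3)%N.
    move: p2; rewrite io => /orP[]; last first.
      move=> /eqP h; have : p (Ordinal (isT : 2 < 3)%N) = p (Ordinal (isT : 1 < 3)%N).
        by rewrite p1; apply/val_inj.
      by move/perm_inj.
    move=> h; apply/val_inj; move: h => /=; by case: (p _) => -[|[|[|m]]].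
  have p0 : p (Ordinal (isT : 0 < 3)%N) = Ordinal (isT : 0 < 3)%N.
    move: (S (Ordinal (isT : 2 < 3)%N)) => /eqP.
    rewrite p2' (_ : rev_ord _ = Ordinal (isT : 0 < 3)%N) //; exact: val_inj.
  apply/permP => -[[|[|[|m]]] lm] //; rewrite perm1.
  - by rewrite (_ : Ordinal lm = Ordinal (isT : 0 < 3)%N) ?p0 //; apply/val_inj.
  - by rewrite (_ : Ordinal lm = Ordinal (isT : 1 < 3)%N) ?p1 //; apply/val_inj.
  - by rewrite (_ : Ordinal lm = Ordinal (isT : 2 < 3)%N) ?p2' //; apply/val_inj.
rewrite /eulerD (eq_bigl _ _ cond) big_pred1_eq /desD (_ : DesD _ = set0) ?cards0 ?expr0 //.
by apply/setP => i; rewrite !inE ord1.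
Qed.

Definition Qpoly (n : nat) : {poly int} :=
  \sum_(k < n) eulerD k * 'C(n, k)%:R * ('X - 1) ^+ (n - k - 1)%N.

(* Evaluation of an integer polynomial at a rational function; the substitution
   of t^-1 for t takes place in the fraction field of the ring Z[t]. *)
Definition fraceval (p : {poly int}) (x : {fraction {poly int}}) :
  {fraction {poly int}} := (map_poly intr p).[x].

Definition tvar : {fraction {poly int}} := tofrac 'X.

Lemma fraceval_tvar (p : {poly int}) : fraceval p tvar = tofrac p.
Proof.
rewrite /fraceval /tvar; elim/poly_ind: p => [|p c IHp].
  by rewrite !rmorph0 horner0.
rewrite !rmorphD !rmorphM /= map_polyX map_polyC hornerMXaddC /= IHp.
by rewrite -[in RHS](intz c) !rmorph_int.
Qed.

(* Main.v *)
Require Import Defs.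
From mathcomp Require Import all_boot all_order all_algebra all_fingroup.
From mathcomp Require Import fraction.
From mathcomp Require Import zify ring.

(* Q_n(t) enumerates, by des_D, the windows of D_n with positive last entry. Let
   c_k (resp. G_k) be the sum of t^(des_D) of the prefix of length k (resp.
   k + 1) over the windows of D_n whose entries after position k are positive
   and decreasing. Such a window is a type D window on a k-subset of [n]
   followed by a forced tail, so c_k = binom(n, k) D_k(t). Moving the first tail
   entry into the prefix multiplies the weight by t exactly when the tail could
   have started one position earlier, so G_k = c_k + (t - 1) G_(k-1); hence
   Q_n = G_(n-1). On the other hand, right multiplication by the longest element
   of D_n complements des_D and changes the sign of the last entry, so that
   t^n Q_n(1/t) enumerates the windows with negative last entry. *)

Set Implicit Arguments.
Unset Strict Implicit.
Unset Printing Implicit Defensive.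

Import Order.TTheory GRing.Theory Num.Theory.
Local Open Scope ring_scope.

(** * Signed words on a set of letters *)

Fixpoint signings (s : seq nat) : seq (seq int) :=
  if s is a :: s' then [seq x :: w | x <- [:: a%:Z; - a%:Z], w <- signings s']
  else [:: [::]].

Definition words (A : seq nat) : seq (seq int) :=
  [seq w | s <- permutations A, w <- signings s].

Definition even_word (w : seq int) : bool := ~~ odd (count (fun x => x < 0) w).

(** Positions in [w] start at 0: index i compares pi(i) with pi(i+1), and the second summand is the
    descent at 0. *)
Definition wdes (w : seq int) : nat :=
  (\sum_(1 <= i < size w) (w`_i <= w`_i.-1)%R
   + ((1 < size w)%N && (w`_0 + w`_1 < 0)%R))%N.

Lemma mem_signings (s : seq nat) (w : seq int) :
  (w \in signings s) = (map absz w == s).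
Proof.
elim: s w => [|a s IHs] [|x w] //; first by apply/negP => /allpairsP[[y v] []].
rewrite eqseq_cons -IHs; apply/allpairsP/andP => [[[y v] /= [yin vin [-> ->]]]|].
  by split=> //; move: yin; rewrite !inE => /orP[] /eqP ->; rewrite ?abszN absz_nat.
move=> [/eqP xa win]; exists (x, w); split=> //=; rewrite !inE; lia.
Qed.

(** The letter 0 would be listed twice, its two signings being equal. *)
Lemma uniq_signings (s : seq nat) : 0%N \notin s -> uniq (signings s).
Proof.
elim: s => // a s IHs; rewrite inE negb_or => /andP[a0 /IHs us].
apply: allpairs_uniq => //; first by rewrite /= inE; lia.
by move=> [? ?] [? ?] _ _ /= [-> ->].
Qed.

Lemma mem_words (A : seq nat) (w : seq int) :
  (w \in words A) = perm_eq (map absz w) A.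
Proof.
apply/allpairsPdep/idP => [[s [v [sA vs ->]]]|wA].
  by move: sA vs; rewrite mem_permutations mem_signings => ? /eqP ->.
by exists (map absz w), w; rewrite mem_permutations mem_signings.
Qed.

Lemma uniq_words (A : seq nat) : 0%N \notin A -> uniq (words A).
Proof.
move=> A0; apply: allpairs_uniq_dep => [|s|[s v] [s' v']] /=.
- exact: permutations_uniq.
- by rewrite mem_permutations => /perm_mem sA; apply: uniq_signings; rewrite sA.
move=> /allpairsPdep[p [q [_ qp [-> ->]]]] /allpairsPdep[p' [q' [_ qp' [-> ->]]]] E.
by move: qp qp'; rewrite !mem_signings E => /eqP -> /eqP ->.
Qed.

Lemma size_words (A : seq nat) (w : seq int) : w \in words A -> size w = size A.
Proof. by rewrite mem_words => /perm_size; rewrite size_map. Qed.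

(** The odd extension of [a] to all integers, given that [a] starts with 0. It serves both to
    rebuild a permutation from its window and to relabel letters. *)
Definition oddext (a : seq int) (x : int) : int :=
  match x with Posz m => a`_m | Negz m => - a`_m.+1 end.

Lemma oddextN (a : seq int) (x : int) :
  a`_0 = 0 -> oddext a (- x) = - oddext a x.
Proof.
by move=> a0; case: x => [[|m]|m]; rewrite ?oppr0 /= ?a0 ?oppr0 ?opprK.
Qed.

(** * Signed permutations and their windows *)

Section Ordinals.
Variable n : nat.
Implicit Types (j : 'I_(n.*2.+1)) (i : int) (pi : {perm 'I_(n.*2.+1)}).

Definition iord i : 'I_(n.*2.+1) := inord (absz (i + n%:Z)).

Lemma iordK i : (`|i| <= n)%N -> ival (iord i) = i.
Proof. by move=> le_in; rewrite /ival /iord inordK; lia. Qed.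

Lemma ival_bound j : (`|ival j| <= n)%N.
Proof. by have := ltn_ord j; rewrite /ival; lia. Qed.

Lemma ival_inj : injective (@ival n).
Proof. by move=> j j'; rewrite /ival => E; apply: val_inj => /=; lia. Qed.

Lemma ivalK j : iord (ival j) = j.
Proof. by apply: ival_inj; rewrite iordK // ival_bound. Qed.

Lemma spvalE pi (k : nat) : spval pi k = ival (pi (iord k)).
Proof. by rewrite /spval /iord; congr (ival (pi (inord _))); lia. Qed.

Lemma signed_permN pi i : signed_perm pi -> (`|i| <= n)%N ->
  ival (pi (iord (- i))) = - ival (pi (iord i)).
Proof.
move=> /forallP/(_ (iord i))/eqP spi le_in.
rewrite -ival_rev_ord -spi; congr (ival (pi _)); apply: ival_inj.
by rewrite ival_rev_ord !iordK //; lia.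
Qed.

Lemma signed_perm0 pi : signed_perm pi -> ival (pi (iord 0)) = 0.
Proof.
move=> /(@signed_permN _ 0)/(_ isT); rewrite oppr0; set a := ival _.
by move: a => a; lia.
Qed.

Lemma signed_perm_inj pi i i' : (`|i| <= n)%N -> (`|i'| <= n)%N ->
  ival (pi (iord i)) = ival (pi (iord i')) -> i = i'.
Proof.
by move=> le_i le_i' /ival_inj/perm_inj/(congr1 (@ival n)); rewrite !iordK.
Qed.

Definition window pi : seq int := mkseq (fun k => spval pi k.+1) n.

(** Injectivity on [-n, n] makes the absolute values distinct, and 0 is taken only at 0; n distinct
    values in [1, n] exhaust it. *)
Lemma window_words pi : signed_perm pi -> window pi \in words (iota 1 n).
Proof.
move=> spi; rewrite mem_words.
have inj : uniq (map absz (window pi)).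
  rewrite -map_comp map_inj_in_uniq ?iota_uniq // => k k'.
  rewrite !mem_iota /= !spvalE => lt_k lt_k' E.
  have [|] : ival (pi (iord k.+1)) = ival (pi (iord k'.+1)) \/
             ival (pi (iord k.+1)) = ival (pi (iord (- k'.+1%:Z))).
  - by rewrite signed_permN //; lia.
  - by move/signed_perm_inj; lia.
  - by move/signed_perm_inj; lia.
have sub : {subset map absz (window pi) <= iota 1 n}.
  move=> a /mapP[_ /mapP[k + ->] ->]; rewrite !mem_iota spvalE => lt_k.
  have [/= E|] := eqVneq (ival (pi (iord k.+1))) 0.
    by move: E; rewrite -(signed_perm0 spi) => /signed_perm_inj; lia.
  by move: (ival _) (ival_bound (pi (iord k.+1))) => v; lia.
have szw : (size (iota 1 n) <= size (map absz (window pi)))%N by rewrite !size_map !size_iota.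
have [_ E] := uniq_min_size inj sub szw.
exact: uniq_perm (iota_uniq _ _) E.
Qed.

Lemma window_inj : {in [pred pi | signed_perm pi] &, injective window}.
Proof.
move=> pi pi'; rewrite !inE => s s' E.
have F k : (k < n)%N -> ival (pi (iord k.+1)) = ival (pi' (iord k.+1)).
  by move=> le_i; have := congr1 (nth 0 ^~ k) E; rewrite /window !nth_mkseq // !spvalE.
apply/permP => j; apply: ival_inj; rewrite -(ivalK j).
have := ival_bound j; case: (ival j) => [[|m]|m] le_m.
- by rewrite (signed_perm0 s) (signed_perm0 s').
- exact: F.
- by rewrite NegzE !signed_permN ?F.
Qed.

(** Prepending 0 and extending oddly gives an injection of the finite set [-n, n] into itself, hence
    a permutation. *)
Lemma window_surj (w : seq int) : w \in words (iota 1 n) ->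
  exists2 pi, signed_perm pi & window pi = w.
Proof.
move=> win; have sw := size_words win; rewrite size_iota in sw.
move: win; rewrite mem_words => pw.
have uw : uniq (map absz w) by rewrite (perm_uniq pw) iota_uniq.
have bw m : (m < n)%N -> (0 < absz (w`_m)%R <= n)%N.
  move=> ltm; have : absz w`_m \in map absz w by rewrite map_f // mem_nth // sw.
  by rewrite (perm_mem pw) mem_iota; lia.
have iw m m' : (m < n)%N -> (m' < n)%N -> absz w`_m = absz w`_m' -> m = m'.
  move=> ltm ltm' E; apply/eqP; rewrite -(nth_uniq 0%N _ _ uw) ?size_map ?sw //.
  by rewrite !(nth_map 0) ?sw // E.
pose f := oddext (0 :: w).
have fb i : (`|i| <= n)%N -> (`|f i| <= n)%N.
  case: i => [[|m]|m] //= le_m; first by have /andP[] := bw m le_m.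
  by rewrite abszN; have /andP[] := bw m le_m.
have fi i i' : (`|i| <= n)%N -> (`|i'| <= n)%N -> f i = f i' -> i = i'.
  rewrite /f; pose v m : int := w`_m.
  have fE x : oddext (0 :: w) x =
    match x with Posz m.+1 => v m | Posz 0 => 0 | Negz m => - v m end.
    by case: x => [[]|].
  rewrite !{}fE; have {}bw m : (m < n)%N -> (0 < absz (v m) <= n)%N := @bw m.
  have {}iw m m' : (m < n)%N -> (m' < n)%N -> absz (v m) = absz (v m') -> m = m' :=
    @iw m m'.
  move: v bw iw => v bw iw.
  case: i i' => [[|m]|m] [[|m']|m'] //= le_m le_m' E.
  - by have := bw m' le_m'; lia.
  - by have := bw m' le_m'; lia.
  - by have := bw m le_m; lia.
  - by have := iw m m' le_m le_m'; lia.
  (* Arguments of opposite signs: m = m' would make [v m] its own negative, but it is nonzero. *)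
  - by have mm : m = m' by [apply: iw => //; lia]; move: (bw m le_m) E; rewrite mm; lia.
  - by have := bw m le_m; lia.
  - by have mm : m = m' by [apply: iw => //; lia]; move: (bw m le_m) E; rewrite mm; lia.
  - by have := iw m m' le_m le_m'; lia.
pose g j := iord (f (ival j)).
have gi : injective g.
  move=> j j' /(congr1 (@ival n)); rewrite !iordK ?fb ?ival_bound //.
  by move/fi => E; apply/ival_inj/E; exact: ival_bound.
exists (perm gi).
  apply/forallP => j; apply/eqP/ival_inj.
  by rewrite ival_rev_ord !permE /g ival_rev_ord !iordK ?oddextN ?fb ?abszN ?ival_bound //;
     rewrite -oddextN // fb // abszN ival_bound.
apply: (@eq_from_nth _ 0) => [|i]; rewrite size_mkseq ?sw // => lt_i.
by rewrite nth_mkseq // spvalE permE /g !iordK // fb ?iordK.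
Qed.

Lemma even_window pi :
  (pi \in typeD n) = signed_perm pi && even_word (window pi).
Proof.
rewrite inE; congr (_ && ~~ odd _).
rewrite count_map -sum1_count -sum1_card (eq_bigl (fun i : 'I_n => spval pi i.+1 < 0)).
  by rewrite -(big_mkord (fun k => spval pi k.+1 < 0) (fun=> 1%N)) /index_iota subn0.
by move=> i; rewrite inE.
Qed.

Lemma wdes_window pi : desD pi = wdes (window pi).
Proof.
have -> : desD pi = (#|Des pi| + ((1 < n)%N && (spval pi 1 + spval pi 2 < 0)%R))%N.
  rewrite /desD /DesD; case: ifP => [/andP[n1 _]|_]; last by rewrite addn0.
  (* Position 0 never lies in [Des pi], so the union is disjoint. *)
  rewrite cardsU (_ : _ :&: _ = set0) ?cards0 ?subn0; last first.
    by apply/setP => i; rewrite !inE andbAC; case: (nat_of_ord i).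
  congr (_ + _)%N; apply/eqP/cards1P.
  by exists (Ordinal (ltnW n1)); apply/setP => i; rewrite !inE.
rewrite /wdes size_mkseq; congr (_ + _)%N; last first.
  by case: ltnP => //= n1; rewrite !nth_mkseq // ltnW.
rewrite -sum1_card (eq_bigl (fun i : 'I_n => (0 < i)%N && (spval pi i.+1 <= spval pi i)));
  last by move=> i; rewrite inE.
rewrite -(big_mkord (fun k => (0 < k)%N && (spval pi k.+1 <= spval pi k)) (fun=> 1%N)).
have [n0|n_gt0] := posnP n; first by rewrite !big_geq // n0.
rewrite big_mkcond big_ltn //= add0n !big_nat; apply: eq_bigr => k lt_k.
by case: k lt_k => // k lt_k; rewrite !nth_mkseq //= 1?ltnW //; case: ifP.
Qed.

Lemma eulerD_words :
  eulerD n = \sum_(w <- words (iota 1 n) | even_word w) 'X^(wdes w).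
Proof.
rewrite /eulerD -big_enum -[RHS]big_filter /=.
under eq_bigr => pi _ do rewrite wdes_window.
rewrite -(big_map window predT (fun w => 'X^(wdes w))); apply: perm_big.
apply: uniq_perm.
- rewrite map_inj_in_uniq ?enum_uniq // => pi pi'.
  rewrite !mem_enum !even_window => /andP[s _] /andP[s' _].
  exact: window_inj.
- by rewrite filter_uniq // uniq_words // mem_iota.
move=> w; rewrite mem_filter; apply/mapP/andP => [[pi + ->]|[ew /window_surj[pi s E]]].
  by rewrite mem_enum even_window => /andP[s ->]; rewrite window_words.
by exists pi; rewrite // mem_enum even_window s E.
Qed.
End Ordinals.

(** * Standardization of words on an arbitrary letter set *)

Lemma wdes_map (f : int -> int) (w : seq int) :
  {in w &, {mono f : x y / x <= y}} ->
  {in w &, forall x y, (f x + f y < 0) = (x + y < 0)} ->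
  wdes (map f w) = wdes w.
Proof.
move=> f_le f_add; rewrite /wdes size_map; congr (_ + _)%N; last first.
  case: ltnP => //= w1; rewrite !(nth_map 0) ?(ltnW w1) //.
  by rewrite f_add // mem_nth // ltnW.
rewrite !big_nat; apply: eq_bigr => -[|i] // lt_i.
by rewrite !(nth_map 0) ?f_le ?mem_nth //= ltnW.
Qed.

Section Standardization.
Variable A : seq nat.
Hypothesis sA : path ltn 0%N A.

Let b (i : nat) : nat := nth 0%N (0%N :: A) i.
(** Goes from ranks to letters: i is sent to the i-th letter of [A], counted from 1 thanks to the
    prepended 0. *)
Definition std : int -> int := oddext (map Posz (0%N :: A)).

Let bE (i : nat) : (map Posz (0%N :: A))`_i = b i.
Proof.
rewrite /b; have [lt_i|le_i] := ltnP i (size (0%N :: A)).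
  by rewrite (nth_map 0%N).
by rewrite !nth_default ?size_map.
Qed.

Let ltb (i j : nat) : (j <= size A)%N -> (i < j)%N -> (b i < b j)%N.
Proof.
move=> le_j lt_ij; apply: (sorted_ltn_nth ltn_trans) => //.
by rewrite inE (leq_trans lt_ij) // ltnW.
Qed.

Lemma std_abs (x : int) : absz (std x) = b (absz x).
Proof. by case: x => m; rewrite /std /oddext bE // abszN. Qed.

Lemma stdN (x : int) : std (- x) = - std x.
Proof. exact: oddextN. Qed.

Lemma std_le : {in [pred x : int | (absz x <= size A)%N] &,
  {mono std : x y / x <= y}}.
Proof.
apply: le_mono_in => -[m|m] [m'|m']; rewrite !inE => le_m le_m' lt_m;
  rewrite /std /oddext !bE; do ?lia.
- by have := @ltb m m' le_m'; move: (b m) (b m') => c c'; lia.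
- by have := @ltb 0%N m.+1 le_m isT; move: (b m') (b m.+1) => c c'; rewrite /b /=; lia.
- by have := @ltb m'.+1 m.+1 le_m; move: (b m'.+1) (b m.+1) => c c'; lia.
Qed.

Lemma std_inj : {in [pred x : int | (absz x <= size A)%N] &, injective std}.
Proof. exact: inc_inj_in std_le. Qed.

Lemma word_bound (k : nat) (w : seq int) (x : int) :
  w \in words (iota 1 k) -> x \in w -> (absz x <= k)%N.
Proof.
rewrite mem_words => /perm_mem pw xw; have := map_f absz xw.
by rewrite pw mem_iota => /andP[_]; rewrite add1n ltnS.
Qed.

Lemma std_lt0 (x : int) : (absz x <= size A)%N -> (std x < 0) = (x < 0).
Proof. by move=> le_x; rewrite !ltNge -[X in X <= std x]/(std 0) std_le. Qed.

Lemma words_std :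
  perm_eq (words A) (map (map std) (words (iota 1 (size A)))).
Proof.
have A0 : 0%N \notin A.
  by apply/negP => /(allP (order_path_min ltn_trans sA)).
have uA : uniq (0%N :: A).
  by rewrite /= A0 (sorted_uniq ltn_trans ltnn) // (path_sorted sA).
apply: uniq_perm; first exact: uniq_words.
  rewrite map_inj_in_uniq ?uniq_words ?mem_iota // => u u' uw u'w.
  apply: (inj_in_map std_inj).
  - by apply/allP => x; apply: word_bound uw.
  - by apply/allP => x; apply: word_bound u'w.
move=> w; apply/idP/mapP => [|[u + ->]]; rewrite !mem_words => pw; last first.
  rewrite -map_comp (eq_map (g := b \o absz)); last exact: std_abs.
  rewrite map_comp (perm_trans (perm_map b pw)) //.
  by rewrite -[X in perm_eq _ X](mkseq_nth 0%N) /mkseq -[1%N]addn0 iotaDl -map_comp.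
(* The inverse relabelling: [idx] is the rank of a letter in [A], and [ind] restores the sign. *)
pose idx (m : nat) := index m (0%N :: A).
pose ind (y : int) : int := if y < 0 then - (idx (absz y))%:Z else idx (absz y).
have indK : {in w, cancel ind std}.
  move=> y yw; have yA : absz y \in 0%N :: A.
    by rewrite inE -(perm_mem pw) map_f ?orbT.
  have H : std (idx (absz y)) = absz y by rewrite /std /oddext bE /b nth_index.
  rewrite /ind; case: ifP => y0; rewrite ?stdN H; lia.
exists (map ind w).
  rewrite mem_words -map_comp (eq_map (g := idx \o absz)); last first.
    by move=> y; rewrite /= /ind; case: ifP => _; rewrite ?abszN absz_nat.
  rewrite map_comp (perm_trans (perm_map idx pw)) //.
  rewrite (_ : map idx A = iota 1 (size A)) //.
  apply: (@eq_from_nth _ 0%N) => [|i]; rewrite size_map ?size_iota // => lt_i.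
  rewrite (nth_map 0%N) // nth_iota // /idx.
  by rewrite -[nth _ A i]/(nth 0%N (0%N :: A) i.+1) index_uniq.
by rewrite -map_comp map_id_in.
Qed.

(** The relabelling is odd and increasing, so it preserves signs and comparisons, hence parity and
    [wdes]. *)
Lemma eulerD_std :
  \sum_(w <- words A | even_word w) 'X^(wdes w) = eulerD (size A).
Proof.
rewrite eulerD_words (perm_big _ words_std) big_map big_seq_cond [RHS]big_seq_cond.
apply: eq_big => [w|w /andP[ww _]].
  case ww: (_ \in _) => //=; rewrite /even_word count_map; congr (~~ odd _).
  by apply: eq_in_count => x xw /=; rewrite std_lt0 // (word_bound ww).
rewrite wdes_map // => x y /(word_bound ww) xA /(word_bound ww) yA.
  exact: std_le.
(* The descent at 0 becomes a comparison of c with - d, which an odd increasing map respects. *)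
have F (c d : int) : (c + d < 0) = ~~ (- d <= c) by lia.
by rewrite !F -stdN std_le // inE abszN.
Qed.

End Standardization.

(** * Words with a positive decreasing tail *)

Definition gtz : rel int := fun x y => y < x.

Lemma gtz_trans : transitive gtz.
Proof. by move=> y x z; rewrite /gtz => yx zy; apply: lt_trans zy yx. Qed.

(* The final 0 encodes positivity of the entries from index k on. *)
Definition dec_tail (k : nat) (w : seq int) : bool :=
  sorted gtz (drop k (rcons w 0)).

Lemma sorted_rcons0 (s : seq int) :
  sorted gtz (rcons s 0) = sorted gtz s && all (fun x => 0 < x) s.
Proof.
have T := gtz_trans.
elim: s => //= x s IHs; rewrite !(path_sortedE T) IHs all_rcons /gtz.
case: (0 < x); rewrite ?andbF //= -!andbA; do 2!bool_congr.
Qed.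

Lemma dec_tailE (k : nat) (w : seq int) : (k <= size w)%N ->
  dec_tail k w = sorted gtz (drop k w) && all (fun x => 0 < x) (drop k w).
Proof. by move=> le_k; rewrite /dec_tail drop_rcons // sorted_rcons0. Qed.

Section Subsets.
Variable n : nat.
Implicit Types (S : {set 'I_n}).

Definition letters S : seq nat := [seq (val i).+1 | i <- enum S].

Lemma sorted_letters S : path ltn 0%N (letters S).
Proof.
rewrite (path_sortedE ltn_trans); apply/andP; split.
  by apply/allP => _ /mapP[i _ ->].
rewrite /letters (map_comp succn val); apply: (homo_sorted (e := ltn)) => //.
apply: (subseq_sorted ltn_trans _ (iota_ltn_sorted 0 n)).
by rewrite -val_enum_ord map_subseq // {2}/enum_mem filter_predT filter_subseq.
Qed.

Lemma uniq_letters S : uniq (letters S).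
Proof. exact: sorted_uniq ltn_trans ltnn _ (path_sorted (sorted_letters S)). Qed.

Lemma size_letters S : size (letters S) = #|S|.
Proof. by rewrite size_map cardE. Qed.

Lemma mem_letters S (i : 'I_n) : ((val i).+1 \in letters S) = (i \in S).
Proof.
apply/mapP/idP => [[j + [/val_inj ->]]|iS]; first by rewrite mem_enum.
by exists i; rewrite ?mem_enum.
Qed.

Lemma letters_sub S : {subset letters S <= iota 1 n}.
Proof. by move=> _ /mapP[i _ ->]; rewrite mem_iota add1n ltnS; exact: ltn_ord. Qed.

Lemma iotaP (a : nat) : a \in iota 1 n -> exists i : 'I_n, a = (val i).+1.
Proof.
rewrite mem_iota; case: a => // a lt_a; have lt_an : (a < n)%N by lia.
by exists (Ordinal lt_an).
Qed.

Lemma perm_lettersC S : perm_eq (letters S ++ letters (~: S)) (iota 1 n).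
Proof.
apply: uniq_perm; rewrite ?iota_uniq //.
  rewrite cat_uniq !uniq_letters andbT /=; apply/hasPn => _ /mapP[i + ->].
  by rewrite mem_enum mem_letters inE.
move=> a; rewrite mem_cat; apply/orP/idP => [[]|/iotaP[i ->]]; try exact: letters_sub.
by rewrite !mem_letters inE; case: (i \in S); [left|right].
Qed.

Lemma perm_letters (u : seq nat) : uniq u -> {subset u <= iota 1 n} ->
  perm_eq u (letters [set i : 'I_n | (val i).+1 \in u]).
Proof.
move=> uu sub; apply: uniq_perm; rewrite ?uniq_letters // => a.
apply/idP/idP => [au|].
  by have [i E] := iotaP (sub _ au); rewrite E mem_letters inE -E.
by case/mapP => i; rewrite mem_enum inE => + ->.
Qed.

(** Cutting off the tail is bijective: the letters missing from the prefix must follow with positive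
    signs in decreasing order. *)
Lemma sum_dec_tail (R : nmodType) (F : seq int -> R) (k : nat) : (k <= n)%N ->
  \sum_(w <- words (iota 1 n) | dec_tail k w) F (take k w) =
  \sum_(S : {set 'I_n} | #|S| == k) \sum_(u <- words (letters S)) F u.
Proof.
move=> le_k; rewrite -[LHS]big_filter -(big_map (take k) predT F).
rewrite -[RHS]big_enum -(big_allpairs_dep (h := fun S u => u)).
have wsz w : w \in words (iota 1 n) -> (k <= size w)%N.
  by move=> /size_words ->; rewrite size_iota.
apply: perm_big; apply: uniq_perm.
- rewrite map_inj_in_uniq; first by rewrite filter_uniq // uniq_words ?mem_iota.
  move=> w w'; rewrite !mem_filter => /andP[t ww] /andP[t' ww'] E.
  move: t t'; rewrite !dec_tailE ?wsz // => /andP[s p] /andP[s' p'].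
  rewrite -(cat_take_drop k w) -(cat_take_drop k w') E; congr (_ ++ _).
  have posK v : all (fun x : int => 0 < x) v -> map Posz (map absz v) = v.
    by move=> /allP v0; rewrite -map_comp map_id_in // => x /v0 /=; lia.
  (* Decreasing tails are equal once they are permutations of each other. Positivity reduces this to
     absolute values, where the common prefix cancels. *)
  apply: (sorted_eq gtz_trans) => //.
    by move=> x y; rewrite /gtz => /andP[xy yx]; have := lt_trans xy yx; rewrite ltxx.
  rewrite -(posK _ p) -(posK _ p'); apply: perm_map.
  rewrite -(perm_cat2l (map absz (take k w'))) -{1}E -!map_cat !cat_take_drop.
  by move: ww ww'; rewrite !mem_words => ww ww'; rewrite (perm_trans ww) // perm_sym.
- apply: allpairs_uniq_dep => [|S _|[S u] [S' u']] /=; first exact: enum_uniq.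
    by apply: uniq_words; apply/negP => /letters_sub; rewrite mem_iota.
  move=> /allpairsPdep[p [q [_ qp [-> ->]]]] /allpairsPdep[p' [q' [_ qp' [-> ->]]]] E.
  suff -> : p = p' by rewrite E.
  apply/setP => i; rewrite -!mem_letters.
  move: qp qp'; rewrite !mem_words E => /perm_mem P /perm_mem P'.
  by rewrite -P -P'.
move=> u; apply/mapP/allpairsPdep => [[w + ->]|[S [u' [+ uS ->]]]].
  rewrite mem_filter => /andP[t ww]; have /= pw := ww; rewrite mem_words in pw.
  have tw : perm_eq (map absz (take k w) ++ map absz (drop k w)) (iota 1 n).
    by rewrite -map_cat cat_take_drop.
  have := iota_uniq 1 n; rewrite -(perm_uniq tw) cat_uniq => /and3P[ut _ _].
  have sub : {subset map absz (take k w) <= iota 1 n}.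
    by move=> a at_; rewrite -(perm_mem tw) mem_cat at_.
  have P := perm_letters ut sub.
  (* The subset is read off from the absolute values in the prefix. *)
  exists [set i : 'I_n | (val i).+1 \in map absz (take k w)], (take k w).
  split; rewrite ?mem_words //.
  rewrite mem_enum unfold_in -size_letters -(perm_size P) size_map size_takel ?wsz //.
  exact: eqxx.
rewrite mem_enum unfold_in => /eqP cS; have su := size_words uS.
rewrite size_letters cS in su.
(* The forced tail: the complementary letters, positive and in decreasing order. *)
exists (u' ++ map Posz (rev (letters (~: S)))); last by rewrite take_size_cat.
rewrite mem_filter mem_words dec_tailE ?size_cat ?su ?leq_addr // drop_size_cat //.
apply/andP; split.
  apply/andP; split.
    rewrite sorted_map rev_sorted; apply: (@sub_sorted _ ltn) => //.
    exact: path_sorted (sorted_letters _).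
  apply/allP => _ /mapP[a + ->]; rewrite mem_rev => /letters_sub.
  by rewrite mem_iota => /andP[].
rewrite map_cat -map_comp (eq_map (g := id)) // map_id.
rewrite mem_words in uS.
by rewrite (perm_trans _ (perm_lettersC S)) // perm_cat // perm_rev.
Qed.

(** A positive tail leaves the parity to the prefix. By standardization each of the binom(n, k)
    prefix letter sets contributes D_k(t). *)
Lemma sum_dec_tail_even (k : nat) : (k <= n)%N ->
  \sum_(w <- words (iota 1 n) | even_word w && dec_tail k w) 'X^(wdes (take k w)) =
  eulerD k * 'C(n, k)%:R.
Proof.
(* Giving odd words weight 0 makes the parity condition part of a function of the prefix. *)
move=> le_k; pose F u : {poly int} := if even_word u then 'X^(wdes u) else 0.
transitivity (\sum_(w <- words (iota 1 n) | dec_tail k w) F (take k w)).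
  rewrite big_mkcondl big_seq_cond [RHS]big_seq_cond.
  apply: eq_bigr => w /andP[ww]; rewrite dec_tailE; last first.
    by rewrite (size_words ww) size_iota.
  case/andP => _ /allP pos; rewrite /F /even_word -{1}(cat_take_drop k w) count_cat.
  rewrite [X in (_ + X)%N](eq_in_count (a2 := pred0)) ?count_pred0 ?addn0 //.
  by move=> x /pos /= x0; rewrite ltNge ltW.
rewrite sum_dec_tail // (eq_bigr (fun=> eulerD k)); last first.
  move=> S /eqP <-; rewrite -size_letters -eulerD_std ?sorted_letters //.
  by rewrite [RHS]big_mkcond.
rewrite sumr_const mulr_natr; congr (_ *+ _).
by have := card_draws 'I_n k; rewrite card_ord => <-; apply: eq_card => S; rewrite !inE.
Qed.
End Subsets.

(** * The recursion on the start of the tail, and Q_n *)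

(** A prefix of length k > 1 already decides the descent at 0, so only one new comparison is
    made. *)
Lemma wdes_takeS (k : nat) (w : seq int) : (1 < k < size w)%N ->
  wdes (take k.+1 w) = (wdes (take k w) + (w`_k <= w`_k.-1)%R)%N.
Proof.
case/andP=> k1 lt_k; rewrite /wdes !size_takel ?(ltnW lt_k) //.
rewrite big_nat_recr ?(ltnW k1) //= !nth_take // ?ltnS ?(ltnW k1) //; last by lia.
rewrite k1 /= -!addnA; congr (_ + _)%N; last by rewrite addnC.
by rewrite !big_nat; apply: eq_bigr => i lt_i; rewrite !nth_take //; lia.
Qed.

Lemma word_nth_neq (n : nat) (w : seq int) (i j : nat) :
  w \in words (iota 1 n) -> (i < n)%N -> (j < n)%N -> i != j ->
  absz w`_i != absz w`_j.
Proof.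
move=> ww; have := size_words ww; rewrite size_iota => sw.
move: ww; rewrite mem_words => pw lt_i lt_j; apply: contra => E.
rewrite -(nth_uniq 0%N _ _ (_ : uniq (map absz w))) ?size_map ?sw //.
  by rewrite !(nth_map 0) ?sw.
by rewrite (perm_uniq pw) iota_uniq.
Qed.

Lemma dec_tailS (k : nat) (w : seq int) : (k < size w)%N ->
  dec_tail k w = (nth 0 (rcons w 0) k.+1 < w`_k) && dec_tail k.+1 w.
Proof.
move=> lt_k; rewrite /dec_tail (drop_nth 0) ?size_rcons 1?ltnW //.
rewrite nth_rcons lt_k.
by rewrite (drop_nth 0 (n := k.+1)) ?size_rcons.
Qed.

Lemma dec_tail_gt0 (k i : nat) (w : seq int) :
  dec_tail k w -> (k <= i < size w)%N -> 0 < w`_i.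
Proof.
move=> t /andP[le_ki lt_i]; move: t; rewrite dec_tailE; last by lia.
case/andP=> _ /allP; apply; rewrite -{1}(subnKC le_ki) -nth_drop mem_nth //.
by rewrite size_drop ltn_sub2r // (leq_ltn_trans le_ki).
Qed.

(* For k = 1 the parity condition forces the first letter to be positive, so
   that neither 0 nor a sign can contribute to a descent. *)
Lemma wdes_dec_tail (n k : nat) (w : seq int) :
  w \in words (iota 1 n) -> even_word w -> (k < n)%N -> dec_tail k w ->
  'X^(wdes (take k.+1 w)) = 'X^(wdes (take k w)) +
    (if (0 < k)%N && dec_tail k.-1 w then ('X - 1) * 'X^(wdes (take k w)) else 0)
  :> {poly int}.
Proof.
move=> ww ew lt_k t; have := size_words ww; rewrite size_iota => sw.
have wk0 := dec_tail_gt0 t (i := k); rewrite sw leqnn lt_k in wk0.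
case: k => [|k] in t lt_k wk0 *.
  by rewrite addr0 /wdes !size_takel ?sw // !big_geq.
(* Starting the tail one position earlier now amounts to [w]_k.+1 < w[_k], the condition for the new
   descent. *)
rewrite /= dec_tailS ?sw 1?ltnW // t andbT nth_rcons sw lt_k.
have nk : absz w`_k != absz w`_k.+1 by rewrite (word_nth_neq ww) // 1?ltnW // ltn_eqF.
have H : (k = 0%N -> 0 <= w`_0) -> 
    wdes (take k.+2 w) = (wdes (take k.+1 w) + (w`_k.+1 < w`_k)%R)%N.
  move=> k0; have E : (w`_k.+1 < w`_k) = (w`_k.+1 <= w`_k).
    by rewrite lt_neqAle; case: eqVneq => //= e; rewrite e eqxx in nk.
  clear nk; case: k => [|k] in k0 t lt_k wk0 E *; last first.
    by rewrite wdes_takeS ?sw //= E.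
  have w0 := k0 erefl; rewrite /wdes !size_takel ?sw //= 1?ltnW //.
  rewrite big_nat1 big_geq // !nth_take //= E addnC.
  by rewrite ltNge addr_ge0 // ltW // wk0.
rewrite H; last first.
  move=> k0; move: t ew; rewrite {}k0 in lt_k *; rewrite dec_tailE ?sw 1?ltnW //.
  case: w sw {ww wk0 nk H} => [|x w] //= sw; rewrite drop0 => /andP[_ /allP pos].
  rewrite /even_word /= (eq_in_count (a2 := pred0)) ?count_pred0 ?addn0.
    by rewrite ltNge; case: (0 <= x).
  by move=> y /pos /= y0; rewrite ltNge ltW.
case: (_ < _); rewrite ?addn0 ?addr0 // addn1 exprS; ring.
Qed.

Lemma Qpoly_words (n : nat) : (0 < n)%N ->
  Qpoly n = \sum_(w <- words (iota 1 n) | even_word w && (0 < w`_n.-1)) 'X^(wdes w).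
Proof.
move=> n0.
pose W := words (iota 1 n).
pose G k : {poly int} :=
  \sum_(w <- W | even_word w && dec_tail k w) 'X^(wdes (take k.+1 w)).
have G0 : G 0%N = eulerD 0 * 'C(n, 0)%:R.
  rewrite -sum_dec_tail_even // /G big_seq_cond [RHS]big_seq_cond.
  apply: eq_bigr => w /andP[ww /andP[ew t]].
  by rewrite (wdes_dec_tail ww ew n0 t) addr0.
have GS k : (k.+1 < n)%N ->
    G k.+1 = eulerD k.+1 * 'C(n, k.+1)%:R + ('X - 1) * G k.
  move=> lt_k; rewrite -sum_dec_tail_even 1?ltnW // /G mulr_sumr.
  rewrite [X in _ = _ + X](_ : _ =
    \sum_(w <- W | even_word w && dec_tail k.+1 w)
     (if dec_tail k w then ('X - 1) * 'X^(wdes (take k.+1 w)) else 0)).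
    rewrite -big_split /= big_seq_cond [RHS]big_seq_cond.
    apply: eq_bigr => w /andP[ww /andP[ew t]].
    by rewrite (wdes_dec_tail ww ew lt_k t).
  (* [dec_tail k w] implies [dec_tail k.+1 w], so the two conditions collapse to the first. *)
  rewrite -big_mkcondr big_seq_cond [RHS]big_seq_cond; apply: eq_bigl => w.
  case ww: (w \in W) => //=; rewrite -andbA; congr (_ && _).
  by rewrite dec_tailS ?(size_words ww) ?size_iota 1?ltnW // andbCA andbb.
have GE k : (k < n)%N ->
    G k = \sum_(i < k.+1) eulerD i * 'C(n, i)%:R * ('X - 1) ^+ (k - i).
  elim: k => [|k IHk] lt_k; first by rewrite big_ord1 G0 expr0 mulr1.
  rewrite big_ord_recr /= subnn expr0 mulr1 GS // IHk 1?ltnW // addrC.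
  congr (_ + _); rewrite mulr_sumr; apply: eq_bigr => i _.
  by rewrite subSn 1?leq_ord // exprS; ring.
transitivity (G n.-1).
  rewrite GE ?prednK // /Qpoly; apply: eq_bigr => i _; congr (_ * _ ^+ _); lia.
rewrite /G big_seq_cond [RHS]big_seq_cond prednK //.
(* A tail of length one only has to exceed the appended 0. *)
have D w : w \in W -> dec_tail n.-1 w = (0 < w`_n.-1).
  move=> ww; have := size_words ww; rewrite size_iota => sw.
  rewrite dec_tailS ?sw ?prednK // nth_rcons sw ltnn eqxx.
  by rewrite /dec_tail drop_rcons ?sw // -sw drop_size andbT.
apply: eq_big => [w|w /andP[ww _]].
  by case ww: (w \in W) => //=; rewrite D.
by rewrite take_oversize // (size_words ww) size_iota.
Qed.

(** * Complementation by the longest element *)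

(* Right multiplication of a window of length n by the longest element of D_n,
   for b the parity of n. *)
Definition wcompl (b : bool) (w : seq int) : seq int :=
  if w is x :: s then (if b then x else - x) :: map -%R s else [::].

Lemma wcomplK (b : bool) : involutive (wcompl b).
Proof.
case=> [|x s] //=; rewrite -map_comp map_id_in => [|y _ /=]; last exact: opprK.
by case: b; rewrite ?opprK.
Qed.

Lemma size_wcompl (b : bool) (w : seq int) : size (wcompl b w) = size w.
Proof. by case: w => //= x s; rewrite size_map. Qed.

Lemma abs_wcompl (b : bool) (w : seq int) : map absz (wcompl b w) = map absz w.
Proof.
case: w => //= x s; rewrite -map_comp (eq_map (g := absz)); last exact: abszN.
by case: b; rewrite ?abszN.
Qed.

Lemma wcompl_words (A : seq nat) (b : bool) (w : seq int) :
  (wcompl b w \in words A) = (w \in words A).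
Proof. by rewrite !mem_words abs_wcompl. Qed.

Lemma nth_wcomplS (b : bool) (w : seq int) (i : nat) :
  (wcompl b w)`_i.+1 = - w`_i.+1.
Proof.
case: w => [|x s] /=; first by rewrite oppr0.
have [lt_i|le_i] := ltnP i (size s); first by rewrite (nth_map 0).
by rewrite !nth_default ?size_map ?oppr0.
Qed.

(** Signs change at n entries for even n and at n - 1 for odd n, an even number either way; no entry
    is 0, so each change flips the parity. *)
Lemma even_wcompl (n : nat) (w : seq int) : w \in words (iota 1 n) ->
  even_word (wcompl (odd n) w) = even_word w.
Proof.
move=> ww; have := size_words ww; rewrite size_iota => sw.
have w0 : 0 \notin w.
  apply/negP => /(map_f absz); move: ww; rewrite mem_words => /perm_mem ->.
  by rewrite mem_iota.
have cN (s : seq int) : 0 \notin s ->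
    odd (count (fun x => x < 0) (map -%R s)) =
    odd (size s) (+) odd (count (fun x => x < 0) s).
  elim: s => //= x s IHs; rewrite inE negb_or !oddD => /andP[x0 /IHs ->].
  by rewrite oppr_lt0; case: (ltgtP x 0) x0 => //=; rewrite ?addbN ?addNb ?negbK.
rewrite /even_word; congr (~~ _); case: w {ww} w0 sw => [|x s] //=.
rewrite inE negb_or !oddD => /andP[x0 s0] <-; rewrite /= cN //.
case: (odd (size s)) => //=.
by rewrite oppr_lt0; case: (ltgtP x 0) x0 => //= _; rewrite negbK.
Qed.

(** Negation reverses comparisons of distinct entries. Keeping the first entry swaps the conditions
    for descents at 0 and 1 and complements both, so either [b] works. *)
Lemma wdes_wcompl (n : nat) (b : bool) (w : seq int) : (1 < n)%N ->
  w \in words (iota 1 n) -> (wdes (wcompl b w) + wdes w)%N = n.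
Proof.
move=> n1 ww; have := size_words ww; rewrite size_iota => sw.
rewrite /wdes size_wcompl sw n1 /= addnACA -big_split /=.
(* Positions 0 and 1 are treated together and contribute 2; each of the other n - 2 contributes
   1. *)
rewrite (big_ltn n1) -addnA addnC -addnA addnC.
rewrite (eq_big_nat _ _ (F2 := fun=> 1%N)) => [|[|[|i]] // lt_i]; last first.
  rewrite !nth_wcomplS lerN2.
  have : absz w`_i.+1 != absz w`_i.+2 by rewrite (word_nth_neq ww) //; lia.
  by move: (w`_i.+1) (w`_i.+2) => x y; lia.
rewrite sum_nat_const_nat muln1 nth_wcomplS.
have : absz w`_0 != absz w`_1 by rewrite (word_nth_neq ww) //; lia.
have -> : (wcompl b w)`_0 = if b then w`_0 else - w`_0.
  by case: w {ww} sw => //= sw; move: n1; rewrite -sw.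
by move: (w`_0) (w`_1) => x y; case: b; lia.
Qed.

Lemma fraceval_sumX (I : Type) (r : seq I) (P : pred I) (d : I -> nat)
  (x : {fraction {poly int}}) :
  fraceval (\sum_(i <- r | P i) 'X^(d i)) x = \sum_(i <- r | P i) x ^+ d i.
Proof.
rewrite /fraceval rmorph_sum horner_sum; apply: eq_bigr => i _.
by rewrite rmorphXn /= map_polyX hornerXn.
Qed.

Lemma sum_wcompl (R : nmodType) (n : nat) (F : nat -> R) : (1 < n)%N ->
  \sum_(w <- words (iota 1 n) | even_word w && (0 < w`_n.-1)) F (n - wdes w)%N =
  \sum_(w <- words (iota 1 n) | even_word w && ~~ (0 < w`_n.-1)) F (wdes w).
Proof.
move=> n1; pose f := wcompl (odd n).
have P : perm_eq (words (iota 1 n)) (map f (words (iota 1 n))).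
  have uW : uniq (words (iota 1 n)) by rewrite uniq_words ?mem_iota.
  apply: uniq_perm; rewrite ?(map_inj_uniq (inv_inj (wcomplK _))) // => w.
  by rewrite -{2}(wcomplK (odd n) w) (mem_map (inv_inj (wcomplK _))) wcompl_words.
rewrite [RHS](perm_big _ P) big_map big_seq_cond [RHS]big_seq_cond.
apply: eq_big => [w|w /andP[ww _]]; last first.
  by rewrite -{1}(wdes_wcompl (odd n) n1 ww) addnK.
case ww: (w \in _) => //=; rewrite /f (even_wcompl ww); congr (_ && _).
(* As n > 1, the last entry is not the first, so it is negated for either parity; being nonzero, it
   changes sign. *)
rewrite -[n.-1]prednK 1?nth_wcomplS; last by lia.
have : absz w`_n.-2.+1 \in iota 1 n.
  have := size_words ww; rewrite size_iota => sw.
  move: ww; rewrite mem_words => /perm_mem <-; rewrite map_f // mem_nth // sw; lia.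
rewrite mem_iota; move: (w`_ _) => x; lia.
Qed.

Theorem theorem1p2 (n : nat) (hn : (2 <= n)%N) :
  fraceval (eulerD n) tvar =
  fraceval (Qpoly n) tvar + tvar ^+ n * fraceval (Qpoly n) tvar^-1.
Proof.
rewrite Qpoly_words 1?ltnW // eulerD_words !fraceval_sumX.
rewrite (bigID (fun w : seq int => 0 < w`_n.-1)) /=; congr (_ + _).
rewrite -(sum_wcompl (fun d => tvar ^+ d) hn) mulr_sumr.
rewrite big_seq_cond [RHS]big_seq_cond; apply: eq_bigr => w /andP[ww _].
have t0 : tvar \is a GRing.unit by rewrite unitfE tofrac_eq0 polyX_eq0.
(* Complementation also bounds [wdes w] by n, so that t^n t^(-d) is t^(n-d) with a natural
   exponent. *)
by rewrite exprVn exprB // -(wdes_wcompl false hn ww) leq_addl.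
Qed.
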